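(* For every $d\ge 3$ there is a constant $\alpha_d>0$ such that, for internal DLA on $\mathbb{Z}^d$ started from the origin with inner error $\delta_I(n)$ and outer error $\delta_O(n)$, $$P\Big(\delta_O(n)\ge \alpha_d\sqrt{\log(n)}\ \text{ or }\ \delta_I(n)\ge \alpha_d\sqrt{\log(n)}\ \text{ for infinitely many integers } n\Big)=1 .$$
   Context: Internal DLA: let $S_1,S_2,\dots$ be independent simple random walks on $\mathbb{Z}^d$, all started at the origin. Define random sets inductively by $A(0)=\emptyset$ and, for $N\ge 1$, $\tau_N=\inf\{t\ge 0: S_N(t)\notin A(N-1)\}$, $A(N)=A(N-1)\cup\{S_N(\tau_N)\}$. Thus $A(N)$ is the cluster produced by $N$ walks, and all clusters $A(N)$, $N\ge 0$, are defined on one probability space with law $P$. Let $\|\cdot\|$ be the Euclidean norm, $\mathbb{B}(0,r)=\{y\in\mathbb{Z}^d:\|y\|<r\}$, and $|\Lambda|$ the cardinality of a set $\Lambda$. The inner error $\delta_I(n)$ and outer error $\delta_O(n)$ are defined by $$n-\delta_I(n)=\sup\{r\ge0:\ \mathbb{B}(0,r)\subset A(|\mathbb{B}(0,n)|)\},\qquad n+\delta_O(n)=\inf\{r\ge0:\ A(|\mathbb{B}(0,n)|)\subset \mathbb{B}(0,r)\}.$$ *)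

(* Defs.v *)
From HB Require Import structures.
From mathcomp Require Import all_boot all_order all_algebra finmap.
From mathcomp Require Import all_classical all_reals all_analysis.

Set Implicit Arguments.
Unset Strict Implicit.
Unset Printing Implicit Defensive.

Import Order.TTheory GRing.Theory Num.Theory.

Local Open Scope classical_set_scope.
Local Open Scope ring_scope.

Notation lattice d := 'rV[int]_d.

(* The library norm on row vectors is the sup norm. *)
Definition euclid_norm (R : realType) (d : nat) (x : lattice d) : R :=
  Num.sqrt (\sum_(i < d) ((x 0 i)%:~R : R) ^+ 2).

Definition lattice_ball (R : realType) (d : nat) (r : R) : set (lattice d) :=
  [set x | euclid_norm R x < r].
Arguments lattice_ball {R} d r _.

Section probability.
Context {R : realType} {disp : measure_display} {T : measurableType disp}.
Variable P : probability T R.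

(* Mutual independence; this is the usual notion when each F i is a
   sigma-algebra. *)
Definition independent_classes (I : choiceType) (F : I -> set_system T) : Prop :=
  forall (J : {fset I}) (E : I -> set T),
    (forall i, i \in J -> F i (E i)) ->
    P (\bigcap_(i in [set` J]) E i) = (\prod_(i <- J) P (E i))%E.

(* Random elements of the countable set Z^d: Z^d carries its discrete
   sigma-algebra, in which every subset is measurable. *)
Definition rv_sigma (d : nat) (X : T -> lattice d) : set_system T :=
  preimage_set_system setT X setT.

Definition walk_sigma (d : nat) (S : nat -> T -> lattice d) : set_system T :=
  <<s \bigcup_t rv_sigma (S t) >>.

Definition step (d : nat) (S : nat -> T -> lattice d) (t : nat) (w : T) :
  lattice d := S t.+1 w - S t w.

Record simple_random_walk (d : nat) (S : nat -> T -> lattice d) : Prop := {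
  srw_measurable : forall t (B : set (lattice d)), measurable (S t @^-1` B) ;
  srw_start : forall w, S 0%N w = 0 ;
  srw_step : forall t (i : 'I_d),
    P (step S t @^-1` [set delta_mx 0 i]) = (((2 * d)%:R)^-1)%:E /\
    P (step S t @^-1` [set - delta_mx 0 i]) = (((2 * d)%:R)^-1)%:E ;
  srw_indep : independent_classes (fun t => rv_sigma (step S t)) }.

Definition independent_walks (d : nat) (S : nat -> nat -> T -> lattice d) : Prop :=
  (forall N, simple_random_walk (S N)) /\
  independent_classes (fun N => walk_sigma (S N)).

End probability.

(* inf {t >= 0 : s t \notin B}, with None for the infimum of the empty set. *)
Definition exit_time (d : nat) (B : set (lattice d)) (s : nat -> lattice d) :
    option nat :=
  if pselect (exists t, `[< ~ B (s t) >]) is left ex then Some (ex_minn ex)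
  else None.

(* [s N] is the trajectory of the walk number N + 1. A walk that never leaves
   the current cluster (an event of probability zero) adds no site. *)
Fixpoint dla_cluster (d : nat) (s : nat -> nat -> lattice d) (N : nat) :
    set (lattice d) :=
  if N is N'.+1 then
    let A := dla_cluster s N' in
    A `|` [set s N' t | t in [set t | exit_time A (s N') = Some t]]
  else set0.

Section errors.
Variables (R : realType) (d : nat) (s : nat -> nat -> lattice d) (n : nat).

Definition ball_cluster : set (lattice d) :=
  dla_cluster s #|` fset_set (lattice_ball d (n%:R : R)) |.

Definition inner_error : R :=
  n%:R - sup [set r : R | 0 <= r /\ lattice_ball d r `<=` ball_cluster].

Definition outer_error : R :=
  inf [set r : R | 0 <= r /\ ball_cluster `<=` lattice_ball d r] - n%:R.

End errors.

(* Main.v *)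
Require Import Defs.
From HB Require Import structures.
From mathcomp Require Import all_boot all_order all_algebra finmap.
From mathcomp Require Import all_classical all_reals all_analysis.
From mathcomp Require Import ring lra zify.

Import Order.TTheory GRing.Theory Num.Theory.

Local Open Scope classical_set_scope.
Local Open Scope ring_scope.

(** Suppose that both errors are smaller than [H] at the radii [n] and
    [n + 2H], and let [z] be a site at distance [n + H] from the origin. Write
    [V(n)] for the number of sites of the ball of radius [n]. Since the outer
    error at [n] is small, [z] is not in the cluster of [V(n)] walks; since the
    inner error at [n + 2H] is small, [z] is in the cluster of [V(n + 2H)]
    walks; and since the outer error at [n + 2H] is small, the walks numbered
    between [V(n)] and [V(n + 2H)] stay in the ball of radius [n + 3H] until
    they settle. So one of these walks visits [z] before it leaves that ball
    ([settled_site_hit]).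

    The probability that a given walk does so is at most [C H / n^(d-1)]: the
    expected number of visits to [z] before leaving a ball whose boundary is at
    distance [2H] from [z] is at most any superharmonic function that is
    nonnegative on the ball and at its neighbours and has Laplacian at most [-1] at the origin, and
    [(|x|^2 + A)^(1 - d/2)], up to a multiplicative and an additive constant,
    is such a function once [A] is large ([radial_power_superharmonic],
    [sum_killed_kernel_le], [pr_confined_hit]). A shell of width [2H] contains on
    average about [H n^(d-1)] sites, so the probability that no walk of the
    block visits [z] is at least about [exp(- c H^2)].

    There are about [N / H] disjoint shells of width [2H] between the radii [N]
    and [2N], and the corresponding blocks of walks are independent. The
    probability that every block visits its site is therefore at most
    [exp(- (N / H) exp(- c H^2))] ([pr_every_block_fails_le]). With
    [N = exp(2 c H^2) / 2], which makes [H] of order [sqrt (log N)], this tends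
    to 0 as [H] tends to infinity ([pr_small_errors_le]). Hence almost surely
    the two errors are not both small from some radius on. *)

(** * Powers of the Euclidean norm *)

Section analysis.
Variable R : realType.
Implicit Types (x y u v s : R) (q : nat).

(** The function [u^(-q/2)], to be applied to [u = |x|^2 + A]; for [q = d - 2]
    this is the radial profile of the Newtonian potential. *)
Definition radial_power q u : R := (Num.sqrt u)^-1 ^+ q.

Lemma radial_power_ge0 q u : 0 <= radial_power q u.
Proof. by rewrite exprn_ge0 // invr_ge0 sqrtr_ge0. Qed.

Lemma radial_powerM q u v : 0 <= u ->
  radial_power q (u * v) = radial_power q u * radial_power q v.
Proof. by move=> u0; rewrite /radial_power sqrtrM // invfM exprMn. Qed.

Lemma le_radial_power q u v : 0 < u -> u <= v ->
  radial_power q v <= radial_power q u.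
Proof.
move=> u0 uv; have v0 : 0 < v by exact: lt_le_trans uv.
by rewrite lerXn2r ?nnegrE ?invr_ge0 ?sqrtr_ge0// lef_pV2 ?posrE ?sqrtr_gt0// ler_wsqrtr.
Qed.

Lemma lt_radial_power q u v : (0 < q)%N -> 0 < u -> u < v ->
  radial_power q v < radial_power q u.
Proof.
move=> q0 u0 uv; have v0 : 0 < v by exact: lt_trans uv.
rewrite ltr_pXn2r ?nnegrE ?invr_ge0 ?sqrtr_ge0//.
by rewrite ltf_pV2 ?posrE ?sqrtr_gt0// ltr_sqrt.
Qed.

Lemma inv_sqrt_taylor y : `|y| <= 1 / 2 ->
  (Num.sqrt (1 + y))^-1 <=
    1 - y / 2 + 3 / 8 * y ^+ 2 - 5 / 16 * y ^+ 3 + 2 * y ^+ 4.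
Proof.
rewrite ler_norml => /andP[y1 y2].
set T := (X in _ <= X).
have T0 : 0 < T.
  have : 0 <= y ^+ 4 by rewrite exprn_even_ge0.
  have : 0 <= (1/2 - y) * y ^+ 2 by rewrite mulr_ge0 ?sqr_ge0 ?subr_ge0.
  rewrite /T; nra.
have y0 : 0 < 1 + y by lra.
rewrite -[leRHS]invrK lef_pV2 ?posrE ?sqrtr_gt0 ?invr_gt0//.
rewrite -[leLHS](gtr0_norm (_ : 0 < T^-1)) ?invr_gt0// -sqrtr_sqr ler_wsqrtr//.
rewrite exprVn -div1r ler_pdivrMr ?exprn_gt0//.
rewrite -subr_ge0.
have -> : (1 + y) * T ^+ 2 - 1 =
  y ^+ 4 * (221 / 64 + y * (71/32 + y * (-163/256 + y * (89/256 + y * (11/4 + 4 * y)))));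
  first by rewrite /T; field.
apply: mulr_ge0; first by rewrite exprn_even_ge0.
have B (u b : R) : - b <= u <= b -> - (b / 2) <= y * u <= b / 2.
  by move=> /andP[? ?]; apply/andP; split; nra.
have /B/andP[? ?] : - (19 / 4) <= 11 / 4 + 4 * y <= 19 / 4 by lra.
have /B/andP[? ?] : - 3 <= 89 / 256 + y * (11 / 4 + 4 * y) <= 3 by lra.
set u3 := y * (89 / 256 + _) in B *.
have /B/andP[? ?] : - (5 / 2) <= -163 / 256 + u3 <= 5 / 2 by rewrite /u3; lra.
set u4 := y * (-163 / 256 + _) in B *.
have /B/andP[? ?] : - 4 <= 71 / 32 + u4 <= 4 by rewrite /u4; lra.
lra.
Qed.

(** The coefficients up to degree 2 are those of the Taylor expansion. The cubic
    one need not be known, since odd terms cancel between opposite neighbours. *)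
Lemma radial_power_taylor q : exists c C : R, 0 <= C /\
  forall y, `|y| <= 1 / 2 ->
  radial_power q (1 + y) <=
    1 - q%:R / 2 * y + q%:R * (q%:R + 2) / 8 * y ^+ 2 + c * y ^+ 3 + C * y ^+ 4.
Proof.
elim: q => [|q [c [C [C0 IH]]]].
  by exists 0, 0; split => // y _; rewrite /radial_power expr0 !mul0r; lra.
set k := q%:R : R in IH *.
pose b1 := - k / 2; pose b2 := k * (k + 2) / 8.
pose a4 := 2 - 5 / 16 * b1 + 3 / 8 * b2 - c / 2 + C.
pose a5 := 2 * b1 - 5 / 16 * b2 + 3 / 8 * c - C / 2.
pose a6 := 2 * b2 - 5 / 16 * c + 3 / 8 * C.
pose a7 := 2 * c - 5 / 16 * C.
pose a8 := 2 * C.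
(* [a4 .. a8] are the coefficients of [y^4 .. y^8] in the product of the bound
   for the exponent [q] with that of [inv_sqrt_taylor]. *)
exists (-5 / 16 + 3 / 8 * b1 - b2 / 2 + c), (`|a4| + `|a5| + `|a6| + `|a7| + `|a8|).
split; first by rewrite !addr_ge0.
move=> y y2; rewrite {1}/radial_power exprSr.
have S0 : 0 <= (Num.sqrt (1 + y))^-1 by rewrite invr_ge0 sqrtr_ge0.
apply: le_trans (ler_pM (radial_power_ge0 _ _) S0 (IH _ y2) (inv_sqrt_taylor _ y2)) _.
rewrite -natr1 -/k.
have Hy j : `|y| ^+ j <= 1 by apply: exprn_ile1 => //; lra.
have Hb (a : R) j : a * y ^+ j <= `|a|.
  by apply: (le_trans (ler_norm _)); rewrite normrM normrX ler_piMr.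
rewrite -subr_ge0.
set D := (X in 0 <= X).
have -> : D = y ^+ 4 * ((`|a4| + `|a5| + `|a6| + `|a7| + `|a8|) -
   (a4 + a5 * y ^+ 1 + a6 * y ^+ 2 + a7 * y ^+ 3 + a8 * y ^+ 4)).
  by rewrite /D /a4 /a5 /a6 /a7 /a8 /b1 /b2; field.
rewrite mulr_ge0 ?exprn_even_ge0// subr_ge0.
by rewrite !lerD// ler_norm.
Qed.

Lemma radial_power_ge1D q v : 0 <= v < 1 ->
  1 + q%:R / 2 * v <= radial_power q (1 - v).
Proof.
move=> /andP[v0 v1].
have H : 1 + v / 2 <= (Num.sqrt (1 - v))^-1.
  rewrite -[leLHS]invrK lef_pV2 ?posrE ?invr_gt0 ?sqrtr_gt0; [|lra..].
  rewrite -[leRHS](gtr0_norm (_ : 0 < (1 + v / 2)^-1)) ?invr_gt0; last lra.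
  rewrite -sqrtr_sqr ler_wsqrtr// exprVn -div1r ler_pdivlMr ?exprn_gt0; [|lra..].
  nra.
apply: (@le_trans _ _ ((1 + v / 2) ^+ q)); last first.
  by rewrite /radial_power lerXn2r ?nnegrE ?invr_ge0 ?sqrtr_ge0//; lra.
elim: q => [|q IH]; first by rewrite expr0; lra.
rewrite exprS -natr1.
have : 0 <= q%:R :> R by [].
have : (1 + v / 2) * (1 + q%:R / 2 * v) <= (1 + v / 2) * (1 + v / 2) ^+ q.
  by rewrite ler_wpM2l//; lra.
nra.
Qed.

(** With [a] and [b] the square roots of the two arguments, this is
    [a^(-q) - b^(-q) <= q (b - a) a^(-q-1)] together with [b - a <= k] and
    [m <= a]. *)
Lemma radial_power_diff q (A m k : R) : 0 <= A -> 0 < m -> 0 <= k ->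
  radial_power q (m ^+ 2 + A) - radial_power q ((m + k) ^+ 2 + A)
    <= q%:R * k * m^-1 ^+ q.+1.
Proof.
move=> A0 m0 k0.
rewrite /radial_power.
set a := Num.sqrt _; set b := Num.sqrt _.
have a2 : a ^+ 2 = m ^+ 2 + A by rewrite sqr_sqrtr// addr_ge0// sqr_ge0.
have b2 : b ^+ 2 = (m + k) ^+ 2 + A by rewrite sqr_sqrtr// addr_ge0// sqr_ge0.
have a0 : 0 <= a by exact: sqrtr_ge0.
have b0 : 0 <= b by exact: sqrtr_ge0.
have am : m <= a by rewrite leNgt; apply/negP => h; nra.
have ab : a <= b by rewrite leNgt; apply/negP => h; nra.
have bk : b <= a + k by rewrite leNgt; apply/negP => h; nra.
clearbody a b.
have ap : 0 < a by lra.
have bp : 0 < b by lra.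
(* Bernoulli's inequality for the ratio [a / b]. *)
have B j : 1 - j%:R * (1 - a / b) <= (a / b) ^+ j.
  have r1 : a / b <= 1 by rewrite ler_pdivrMr// mul1r.
  have r0 : 0 <= a / b by rewrite divr_ge0.
  elim: j => [|j IH]; first by rewrite expr0; lra.
  rewrite exprS -natr1.
  have h : a / b * (1 - j%:R * (1 - a / b)) <= a / b * (a / b) ^+ j by rewrite ler_wpM2l.
  have j0 : 0 <= j%:R :> R by [].
  have := mulr_ge0 j0 (sqr_ge0 (1 - a / b)).
  nra.
have -> : a^-1 ^+ q - b^-1 ^+ q = a^-1 ^+ q * (1 - (a / b) ^+ q).
  by rewrite mulrBr mulr1 -exprMn mulrA mulVf ?mul1r ?gt_eqF.
have am1 : a^-1 <= m^-1 by rewrite lef_pV2.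
have E1 : 1 - (a / b) ^+ q <= q%:R * k * m^-1.
  have := B q.
  suff : (1 - a / b) <= k * m^-1.
    move=> h; have : q%:R * (1 - a / b) <= q%:R * (k * m^-1) by rewrite ler_wpM2l.
    lra.
  apply: (@le_trans _ _ (k * b^-1)); last first.
    by rewrite ler_wpM2l// lef_pV2 ?posrE//; lra.
  rewrite -{1}(@divff _ b) ?gt_eqF//.
  by rewrite -mulrBl ler_wpM2r ?invr_ge0//; lra.
rewrite exprSr [leRHS]mulrCA.
apply: ler_pM => //.
- by rewrite exprn_ge0 ?invr_ge0.
- by rewrite subr_ge0 exprn_ile1// ?divr_ge0// ler_pdivrMr ?mul1r.
- by rewrite lerXn2r// nnegrE invr_ge0; lra.
Qed.

End analysis.

(** * A superharmonic function and the Green function of a ball *)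

Section lattice_geometry.
Variables (R : realType) (d : nat).
Implicit Types (x y : lattice d) (e : 'I_d * bool).

(** The [2d] unit vectors, indexed by an axis and a sign. *)
Definition neighbor_step e : lattice d :=
  if e.2 then delta_mx 0 e.1 else - delta_mx 0 e.1.

(** Square of the Euclidean norm. *)
Definition sqnorm x : R := \sum_(i < d) ((x 0 i)%:~R : R) ^+ 2.

Lemma sqnorm_ge0 x : 0 <= sqnorm x.
Proof. by apply: sumr_ge0 => i _; exact: sqr_ge0. Qed.

Lemma euclid_norm_ge0 x : 0 <= euclid_norm R x.
Proof. exact: sqrtr_ge0. Qed.

Lemma sqr_euclid_norm x : euclid_norm R x ^+ 2 = sqnorm x.
Proof. by rewrite sqr_sqrtr// sqnorm_ge0. Qed.

Lemma sqnorm0 : sqnorm 0 = 0.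
Proof. by apply: big1 => i _; rewrite mxE expr0n. Qed.

Lemma sqr_coord_le x i : ((x 0 i)%:~R : R) ^+ 2 <= sqnorm x.
Proof.
rewrite /sqnorm (bigD1 i)//= lerDl.
by apply: sumr_ge0 => j _; exact: sqr_ge0.
Qed.

Lemma sqnorm_neighbor x i b : sqnorm (x - neighbor_step (i, b)) =
  sqnorm x + 1 + (if b then -1 else 1) * (2 * (x 0 i)%:~R).
Proof.
rewrite /sqnorm (bigD1 i)//= [in RHS](bigD1 i)//=.
have -> : \sum_(j < d | j != i)
    (((x - neighbor_step (i, b)) 0 j)%:~R : R) ^+ 2 =
    \sum_(j < d | j != i) ((x 0 j)%:~R : R) ^+ 2.
  apply: eq_bigr => j ji; rewrite /neighbor_step /=.
  by case: b; rewrite !mxE eqxx (negbTE ji) ?oppr0 ?subr0 ?addr0.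
rewrite /neighbor_step /=.
by case: b; rewrite !mxE !eqxx/= ?opprK !rmorphD ?rmorphN/= ; ring.
Qed.

Lemma euclid_norm_neighbor (M : R) x e : euclid_norm R x < M ->
  euclid_norm R (x - neighbor_step e) < M + 1.
Proof.
move=> xM; apply: le_lt_trans (_ : _ <= euclid_norm R x + 1) _; last lra.
have x0 := euclid_norm_ge0 x.
rewrite -[leRHS](ger0_norm (_ : 0 <= euclid_norm R x + 1)); last lra.
rewrite -sqrtr_sqr ler_wsqrtr// -/(sqnorm _).
case: e => i b; rewrite sqnorm_neighbor.
have := sqr_coord_le x i; rewrite -sqr_euclid_norm.
set u := (x 0 i)%:~R; set v := euclid_norm R x in x0 *.
move=> uv.
have [u1 u2] : - v <= u /\ u <= v.
  apply/andP; rewrite -ler_norml -(ger0_norm x0) -ler_sqr ?nnegrE ?normr_ge0//.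
  by rewrite !real_normK ?num_real.
by case: b; nra.
Qed.

Lemma sum_neighbor_step (V : nmodType) (F : 'I_d * bool -> V) :
  \sum_e F e = \sum_(i < d) (F (i, true) + F (i, false)).
Proof.
transitivity (\sum_(i < d) \sum_b F (i, b)).
  by rewrite pair_bigA; apply: eq_bigr => -[].
by apply: eq_bigr => i _; rewrite big_bool.
Qed.

End lattice_geometry.

Section green.
Variables (R : realType) (d : nat).
Hypothesis d3 : (3 <= d)%N.
Implicit Types (x y : lattice d) (e : 'I_d * bool).
Let q := d.-2.

Let dE : d%:R = q%:R + 2 :> R.
Proof. by rewrite -natrD /q addn2; case: d d3 => [|[|]]. Qed.

Let q1 : (1 : R) <= q%:R.
Proof. by rewrite ler1n /q; case: d d3 => [|[|[]]]. Qed.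

(** The function [(|x|^2 + A)^(-q/2)] with [q = d - 2] has continuous Laplacian
    [- d (d - 2) A (|x|^2 + A)^(-(d+2)/2)]; the discrete Laplacian differs from it
    by at most a constant times [(|x|^2 + A)^(-(d+2)/2)], so a large [A] wins. *)
Lemma radial_power_superharmonic : exists A : R, 0 < A /\
  forall x, \sum_e radial_power R q (sqnorm R d (x - neighbor_step d e) + A)
    <= (2 * d)%:R * radial_power R q (sqnorm R d x + A).
Proof.
have [c [C [C0 Tq]]] := radial_power_taylor R q.
exists (32 * C + 3); split; first by lra.
move=> x; set A := 32 * C + 3.
have N0 := sqnorm_ge0 R d x.
set N := sqnorm R d x in N0 *.
pose s := N + A + 1.
have s0 : 0 < s by rewrite /s /A; lra.
pose y (i : 'I_d) : R := 2 * (x 0 i)%:~R / s.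
have y2 i : `|y i| <= 1 / 2.
  rewrite /y normrM (gtr0_norm (_ : 0 < s^-1)) ?invr_gt0// ler_pdivrMr//.
  have := sqr_coord_le R d x i; rewrite -/N /s /A.
  move: (_%:~R) => u uN; rewrite ler_norml; apply/andP; split.
    by have := sqr_ge0 (u + 2); nra.
  by have := sqr_ge0 (u - 2); nra.
have E i b : radial_power R q (sqnorm R d (x - neighbor_step d (i, b)) + A) =
    radial_power R q s * radial_power R q (1 + (if b then - y i else y i)).
  rewrite -radial_powerM ?(ltW s0)// sqnorm_neighbor -/N; congr radial_power.
  have ys : s * y i = 2 * (x 0 i)%:~R by rewrite /y mulrC divfK ?gt_eqF.
  by case: b; rewrite mulrDr mulr1 ?mulrN ys /s; ring.
rewrite sum_neighbor_step.
under eq_bigr => i _ do rewrite !E -mulrDr.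
rewrite -mulr_sumr.
have -> : N + A = s * (1 - s^-1).
  by rewrite mulrBr mulr1 divff ?gt_eqF// /s; ring.
rewrite radial_powerM ?(ltW s0)// mulrCA.
apply: ler_wpM2l; first exact: radial_power_ge0.
have V01 : 0 <= s^-1 < 1.
  rewrite invr_ge0 (ltW s0)/= invf_lt1//.
  by rewrite /s /A; lra.
apply: (@le_trans _ _ ((2 * d)%:R * (1 + q%:R / 2 * s^-1))); last first.
  by rewrite ler_wpM2l// radial_power_ge1D.
(* [Y = 4 N / s^2] with [N = s - A - 1]: the part of [Y] linear in [1 / s] matches
   the first-order term at [x], and the rest is negative of order [A / s^2]. *)
pose Y := \sum_i y i ^+ 2.
have YE : Y = 4 * N * s^-1 ^+ 2.
  rewrite /Y /N /sqnorm mulr_sumr mulr_suml; apply: eq_bigr => i _.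
  by rewrite /y; ring.
have Y4 : \sum_i y i ^+ 4 <= Y ^+ 2.
  rewrite expr2 {1}/Y mulr_suml; apply: ler_sum => i _.
  rewrite (exprD _ 2 2); apply: ler_wpM2l; first exact: sqr_ge0.
  rewrite /Y (bigD1 i)//= lerDl; apply: sumr_ge0 => j _; exact: sqr_ge0.
apply: (@le_trans _ _ (\sum_(i < d)
    (2 + q%:R * (q%:R + 2) / 4 * y i ^+ 2 + 2 * C * y i ^+ 4))).
  apply: ler_sum => i _.
  have h1 := Tq _ (y2 i).
  have := Tq (- y i); rewrite normrN => /(_ (y2 i)) h2.
  apply: le_trans (lerD h2 h1) _.
  by rewrite le_eqVlt; apply/orP; left; apply/eqP; field.
rewrite !big_split/= -!mulr_sumr sumr_const card_ord -/Y.
apply: (@le_trans _ _ (d%:R * 2 + q%:R * (q%:R + 2) / 4 * Y + 2 * C * Y ^+ 2)).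
  have : 2 * C * \sum_(i < d) y i ^+ 4 <= 2 * C * Y ^+ 2 by rewrite ler_wpM2l//; lra.
  lra.
set v := s^-1 in V01 YE *.
have vs : v * s = 1 by rewrite /v mulVf// gt_eqF.
have {}YE : Y = 4 * v - 4 * (A + 1) * v ^+ 2.
  have NE : N = s - (A + 1) by rewrite /s; ring.
  have -> : Y = 4 * v * (v * s) - 4 * (A + 1) * v ^+ 2 by rewrite YE NE; ring.
  by rewrite vs mulr1.
clearbody v.
have Y0 : 0 <= Y by rewrite /Y; apply: sumr_ge0 => i _; exact: sqr_ge0.
have Yv : Y <= 4 * v by rewrite YE; have := sqr_ge0 v; rewrite /A; nra.
have YY : Y ^+ 2 <= 16 * v ^+ 2 by nra.
rewrite natrM dE.
have h1 : 2 * C * Y ^+ 2 <= 32 * C * v ^+ 2 by nra.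
have h2 : q%:R * (q%:R + 2) / 4 * Y =
   q%:R * (q%:R + 2) * v - q%:R * (q%:R + 2) * (A + 1) * v ^+ 2.
  by rewrite YE; field.
have h3 : 32 * C * v ^+ 2 <= q%:R * (q%:R + 2) * (A + 1) * v ^+ 2.
  apply: ler_wpM2r; first exact: sqr_ge0.
  have K1 : 1 <= q%:R * (q%:R + 2) :> R.
    by rewrite -[leLHS]mulr1 ler_pM//; apply: le_trans q1 _; rewrite lerDl.
  by apply: le_trans (_ : _ <= 1 * (A + 1)) _; [|rewrite ler_wpM2r//]; rewrite /A; lra.
rewrite h2; lra.
Qed.

(** Probability that simple random walk from the origin is at [y] at time [t]
    and has stayed in the ball of radius [M] up to then, defined by the
    recursion on the last step. *)
Fixpoint killed_kernel (M : R) (t : nat) (y : lattice d) : R :=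
  if `[< lattice_ball d M y >] then
    if t is t'.+1 then
      (\sum_e killed_kernel M t' (y - neighbor_step d e)) / (2 * d)%:R
    else (y == 0)%:R
  else 0.

Lemma killed_kernel_ge0 M t y : 0 <= killed_kernel M t y.
Proof.
elim: t y => [|t IH] y /=; case: ifP => // _.
by rewrite divr_ge0// sumr_ge0.
Qed.

Lemma killed_kernel_out M t y : ~ lattice_ball d M y -> killed_kernel M t y = 0.
Proof. by move=> h; case: t => [|t] /=; case: asboolP. Qed.

Let dpos : 0 < (2 * d)%:R :> R.
Proof. by rewrite ltr0n muln_gt0/=; case: d d3. Qed.

(** The partial sums [g_n] of the killed kernel satisfy [g_(n+1) = delta_0 + Q g_n]
    inside the ball, where [Q] is the symmetric averaging operator, so they stay
    below any solution of [delta_0 + Q psi <= psi]. Only neighbours of the ball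
    enter, hence the radius [M + 1] for positivity. *)
Lemma sum_killed_kernel_superharmonic (psi : lattice d -> R) (M : R) :
  (forall y, euclid_norm R y < M + 1 -> 0 <= psi y) ->
  (forall y, (\sum_e psi (y - neighbor_step d e)) / (2 * d)%:R + (y == 0)%:R
     <= psi y) ->
  forall n y, euclid_norm R y < M + 1 ->
    \sum_(t < n) killed_kernel M t y <= psi y.
Proof.
move=> psi0 psiS; elim => [|n IH] y yM; first by rewrite big_ord0 psi0.
have [yB|yB] := pselect (lattice_ball d M y); last first.
  by rewrite big1 ?psi0// => t _; rewrite killed_kernel_out.
rewrite big_ord_recl /= (asboolT yB).
apply: le_trans (psiS y); rewrite addrC lerD2r.
rewrite -mulr_suml ler_pM2r ?invr_gt0//.
rewrite exchange_big/=; apply: ler_sum => e _.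
by apply: IH; exact: euclid_norm_neighbor.
Qed.

(** Expected number of visits to a site at distance [m] from the origin and [k]
    from the boundary of the ball, with linear decay towards the boundary. *)
Lemma sum_killed_kernel_le : exists C : R, 0 < C /\
  forall (i : 'I_d) (m k n : nat), (0 < m)%N -> (0 < k)%N ->
  \sum_(t < n) killed_kernel (m + k)%:R t (m%:Z *: delta_mx 0 i)
    <= C * k.+1%:R * (m%:R^-1) ^+ d.-1.
Proof.
have [A [A0 SH]] := radial_power_superharmonic.
have q0 : (0 < q)%N by rewrite /q; case: d d3 => [|[|[]]].
have q0R : 0 < q%:R :> R by rewrite ltr0n.
pose D := radial_power R q A - radial_power R q (1 + A).
have D0 : 0 < D by rewrite subr_gt0 lt_radial_power//; lra.
exists (q%:R / D); split; first by rewrite divr_gt0.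
move=> i m k n m0 k0.
pose M : R := (m + k)%:R.
have M0 : 0 <= M by [].
pose psi y := (radial_power R q (sqnorm R d y + A)
   - radial_power R q ((M + 1) ^+ 2 + A)) / D.
have zE : sqnorm R d (m%:Z *: delta_mx 0 i) = m%:R ^+ 2.
  rewrite /sqnorm (bigD1 i)//= big1 ?addr0 => [|j ji].
    by rewrite !mxE !eqxx mulr1.
  by rewrite !mxE (negbTE ji) andbF mulr0 expr0n.
apply: le_trans (_ : _ <= psi (m%:Z *: delta_mx 0 i)) _; last first.
  rewrite /psi zE ler_pdivrMr//.
  have -> : M + 1 = m%:R + k.+1%:R by rewrite /M natrD -natr1 addrA.
  apply: le_trans (radial_power_diff _ _ _ _ _ _ _ _) _; rewrite ?ltr0n// ?(ltW A0)//.
  have -> : q.+1 = d.-1 by rewrite /q; case: d d3 => [|[]].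
  by rewrite le_eqVlt; apply/orP; left; apply/eqP; field; rewrite gt_eqF.
apply: sum_killed_kernel_superharmonic.
- move=> y yM; rewrite divr_ge0 ?(ltW D0)// subr_ge0 le_radial_power//.
    by rewrite ltr_wpDl// sqnorm_ge0.
  have y0 := euclid_norm_ge0 R d y.
  by rewrite -sqr_euclid_norm lerD2r lerXn2r ?nnegrE//; lra.
- move=> y; set b := radial_power R q ((M + 1) ^+ 2 + A) in psi *.
  pose S := \sum_e radial_power R q (sqnorm R d (y - neighbor_step d e) + A).
  have -> : \sum_e psi (y - neighbor_step d e) = (S - (2 * d)%:R * b) / D.
    rewrite /psi -mulr_suml big_split/= sumr_const card_prod card_ord card_bool.
    by rewrite mulnC mulNrn mulr_natl.
  suff : S + (y == 0)%:R * ((2 * d)%:R * D) <=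
      (2 * d)%:R * radial_power R q (sqnorm R d y + A).
    have dn0 : d%:R != 0 :> R by rewrite pnatr_eq0; case: d d3.
    move=> h; have -> : psi y = ((2 * d)%:R * radial_power R q (sqnorm R d y + A)
       - (2 * d)%:R * b) / D / (2 * d)%:R.
      by rewrite /psi -/b; field; rewrite dn0 gt_eqF.
    have -> : (y == 0)%:R = ((y == 0)%:R * ((2 * d)%:R * D)) / D / (2 * d)%:R :> R.
      by field; rewrite dn0 gt_eqF.
    by rewrite -!mulrDl !ler_pM2r ?invr_gt0// addrAC lerD2r.
  have [y0|y0] := eqVneq y 0; last by rewrite mul0r addr0 SH.
  have -> : S = (2 * d)%:R * radial_power R q (1 + A); last first.
    by rewrite y0 sqnorm0 mul1r add0r /D; lra.
  rewrite /S y0 (eq_bigr (fun=> radial_power R q (1 + A))) => [|[e s] _].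
    by rewrite sumr_const card_prod card_ord card_bool mulnC mulr_natl.
  congr (radial_power R q (_ + A)).
  by rewrite sqnorm_neighbor sqnorm0 mxE mulr0 mulr0 addr0 add0r.
- rewrite -(ltr_pXn2r (_ : 0 < 2)%N) ?nnegrE ?euclid_norm_ge0 ?addr_ge0//.
  rewrite sqr_euclid_norm zE ltr_pXn2r ?nnegrE ?addr_ge0//.
  by rewrite /M natrD -addrA ltrDl ltr_wpDl.
Qed.


End green.

(** * Probability that a walk visits a site before leaving a ball *)

Section real_probability.
Context {R : realType} {disp : measure_display} {T : measurableType disp}.
Variable P : probability T R.
Implicit Types A B : set T.

(** Real-valued probability of an event. *)
Definition pr A : R := fine (P A).

Lemma prE A : measurable A -> P A = (pr A)%:E.
Proof. by move=> mA; rewrite /pr fineK// fin_num_measure. Qed.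

Lemma pr_ge0 A : 0 <= pr A.
Proof. by rewrite fine_ge0. Qed.

Lemma pr_le1 A : measurable A -> pr A <= 1.
Proof. by move=> mA; rewrite -lee_fin -prE// probability_le1. Qed.

Lemma le_pr A B : measurable A -> measurable B -> A `<=` B -> pr A <= pr B.
Proof.
by move=> mA mB AB; rewrite -lee_fin -!prE// le_measure// inE.
Qed.

Lemma pr_setC A : measurable A -> pr (~` A) = 1 - pr A.
Proof.
move=> mA; apply: EFin_inj.
by rewrite -prE ?probability_setC// ?prE//; exact: measurableC.
Qed.

Lemma pr_setU_le A B : measurable A -> measurable B ->
  pr (A `|` B) <= pr A + pr B.
Proof.
move=> mA mB; rewrite -lee_fin EFinD -!prE//; last exact: measurableU.
exact: measureU2.
Qed.

Lemma pr_setU A B : measurable A -> measurable B -> A `&` B = set0 ->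
  pr (A `|` B) = pr A + pr B.
Proof.
move=> mA mB AB; apply: EFin_inj.
by rewrite EFinD -!prE//; [rewrite measureU|exact: measurableU].
Qed.

Lemma pr_split A B : measurable A -> measurable B ->
  pr A = pr (A `\` B) + pr (A `&` B).
Proof.
move=> mA mB; apply: EFin_inj.
rewrite EFinD -!prE//; [exact: measureDI|exact: measurableI|exact: measurableD].
Qed.

Lemma measurable_bigsetU_seq (I : Type) (s : seq I) (F : I -> set T) :
  (forall i, measurable (F i)) -> measurable (\big[setU/set0]_(i <- s) F i).
Proof.
by move=> mF; elim/big_rec: _ => [|i x _ mx]; [exact: measurable0|exact: measurableU].
Qed.

Lemma pr_cover_finite (I : finType) (F : I -> set T) (X : set T) :
  measurable X -> (forall i, measurable (F i)) ->
  (forall w, X w -> exists i, F i w) -> pr X <= \sum_i pr (F i).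
Proof.
move=> mX mF XF.
apply: (@le_trans _ _ (pr (\big[setU/set0]_i F i))).
  apply: le_pr => //; first exact: measurable_bigsetU_seq.
  by move=> w /XF[i Fi]; rewrite -bigcup_seq; exists i => //=; rewrite mem_index_enum.
elim: (index_enum I) => [|i s IH].
  by rewrite !big_nil /pr measure0.
rewrite !big_cons; apply: le_trans (pr_setU_le _ _ _ _) _ => //.
  exact: measurable_bigsetU_seq.
by rewrite lerD2l.
Qed.

Lemma pr_partition_setC (I : finType) (F : I -> set T) :
  (forall i, measurable (F i)) -> trivIset setT F ->
  \sum_i pr (F i) = 1 -> pr [set w | forall i, ~ F i w] = 0.
Proof.
move=> mF tF S1.
have -> : [set w | forall i, ~ F i w] = ~` \big[setU/set0]_i F i.
  apply/seteqP; split => [w Fw|w nF i Fi].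
    by rewrite -bigcup_seq => -[i _]; exact: Fw.
  by apply: nF; rewrite -bigcup_seq; exists i => //=; rewrite mem_index_enum.
rewrite pr_setC; last exact: measurable_bigsetU_seq.
suff -> : pr (\big[setU/set0]_i F i) = \sum_i pr (F i) by rewrite S1 subrr.
have : uniq (index_enum I) by exact: index_enum_uniq.
elim: (index_enum I) => [|i s IH].
  by rewrite !big_nil /pr measure0.
rewrite !big_cons /= => /andP[nis us].
rewrite pr_setU ?IH//; first exact: measurable_bigsetU_seq.
apply/seteqP; split => // w [Fi]; rewrite -bigcup_seq => -[j /= js Fj].
have ij : i = j by apply: tF => //; exists w.
by move: nis; rewrite ij js.
Qed.

Lemma pr_cover_countable (F : nat -> set T) (X : set T) (b : R) :
  measurable X -> (forall i, measurable (F i)) ->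
  X `<=` \bigcup_i F i ->
  (forall n, \sum_(i < n) pr (F i) <= b) -> pr X <= b.
Proof.
move=> mX mF XF Fb; rewrite -lee_fin -prE//.
apply: (@le_trans _ _ (P (\bigcup_i F i))).
  by rewrite le_measure ?inE//; exact: bigcupT_measurable.
apply: le_trans (generalized_Boole_inequality _ _ _) _ => //.
  exact: bigcupT_measurable.
apply: lime_le; first exact: is_cvg_nneseries.
apply: nearW => n; rewrite big_mkord.
rewrite (eq_bigr (fun i : 'I_n => (pr (F i))%:E)) => [|i _]; last exact: prE.
by rewrite sumEFin lee_fin; exact: Fb.
Qed.

Lemma independent_pr (I : choiceType) (F : I -> set_system T) (J : {fset I})
    (E : I -> set T) :
  independent_classes P F -> (forall i, i \in J -> F i (E i)) ->
  (forall i, i \in J -> measurable (E i)) ->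
  pr (\bigcap_(i in [set` J]) E i) = \prod_(i <- J) pr (E i).
Proof.
move=> ind FE mE; rewrite {1}/pr ind//.
rewrite big_seq (eq_bigr (fun i => (pr (E i))%:E)); last first.
  by move=> i iJ; rewrite prE//; exact: mE.
by rewrite prodEFin/= -big_seq.
Qed.

End real_probability.

Section one_walk.
Context {R : realType} {disp : measure_display} {T : measurableType disp}.
Variable P : probability T R.
Variables (d : nat) (S : nat -> T -> lattice d).
Hypothesis d3 : (3 <= d)%N.
Hypothesis srw : simple_random_walk P S.
Implicit Types (e : 'I_d * bool) (u : nat -> 'I_d * bool).

Lemma measurable_walk_pred t (Q : lattice d -> Prop) :
  measurable [set w | Q (S t w)].
Proof. exact: (srw_measurable srw t [set x | Q x]). Qed.

Lemma measurable_walk_pred2 t t' (Q : lattice d -> lattice d -> Prop) :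
  measurable [set w | Q (S t w) (S t' w)].
Proof.
have -> : [set w | Q (S t w) (S t' w)] =
    \bigcup_(x in [set: lattice d]) ([set w | S t w = x] `&` [set w | Q x (S t' w)]).
  apply/seteqP; split => [w Qw|w [x _ [/= <-]]//].
  by exists (S t w).
apply: countable_bigcupT_measurable; first exact: countableP.
move=> x; apply: measurableI.
  exact: (measurable_walk_pred t (fun z => z = x)).
exact: (measurable_walk_pred t' (Q x)).
Qed.

Lemma measurable_step_pred t (Q : lattice d -> Prop) :
  measurable [set w | Q (step S t w)].
Proof. exact: (measurable_walk_pred2 t.+1 t (fun a b => Q (a - b))). Qed.

(** The walk is at [y] at time [t] and has stayed in the ball of radius [M]. *)
Definition confined_at (M : R) (t : nat) (y : lattice d) : set T :=
  [set w | S t w = y /\ forall s, (s <= t)%N -> lattice_ball d M (S s w)].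

(** The [k] steps from time [t] on are those prescribed by [u]. *)
Definition steps_along (t k : nat) u : set T :=
  [set w | forall j, (j < k)%N -> step S (t + j) w = neighbor_step d (u j)].

Lemma measurable_confined_at M t y : measurable (confined_at M t y).
Proof.
have -> : confined_at M t y = [set w | S t w = y] `&`
    \bigcap_(s in [set s | (s <= t)%N]) [set w | lattice_ball d M (S s w)].
  by apply/seteqP; split.
apply: measurableI; first exact: (measurable_walk_pred t (fun z => z = y)).
apply: bigcap_measurableType => s _.
exact: (measurable_walk_pred s (lattice_ball d M)).
Qed.

Lemma measurable_steps_along t k u : measurable (steps_along t k u).
Proof.
apply: (@bigcap_measurableType _ _ (fun j => [set w | step S (t + j) w = neighbor_step d (u j)])
   [set j | (j < k)%N]) => j _; exact: (measurable_step_pred (t + j) (fun x => x = _)).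
Qed.

Let d0 : (0 < d)%N.
Proof. by case: d d3. Qed.

Lemma pr_neighbor_step t e :
  pr P [set w | step S t w = neighbor_step d e] = (2 * d)%:R^-1.
Proof.
case: e => i b; have [h1 h2] := srw_step srw t i.
by rewrite /pr /neighbor_step; case: b => /=; [rewrite [X in fine X]h1|rewrite [X in fine X]h2].
Qed.

Lemma neighbor_step_inj : injective (@neighbor_step d).
Proof.
move=> [i b] [j c] /(congr1 (fun x : lattice d => x 0 i)).
rewrite /neighbor_step; case: b; case: c; rewrite !mxE !eqxx/=; case: eqVneq => // ->//.
Qed.

(** The step from time [t] is not a unit vector; the [2d] step probabilities sum
    to 1, so this has probability 0. *)
Definition non_neighbor_step (t : nat) : set T :=
  [set w | forall e, step S t w <> neighbor_step d e].

Lemma pr_non_neighbor_step t : pr P (non_neighbor_step t) = 0.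
Proof.
apply: pr_partition_setC.
- by move=> e; exact: (measurable_step_pred t (fun x => x = _)).
- by move=> e e' _ _ [w [/= -> /neighbor_step_inj]].
under eq_bigr do rewrite pr_neighbor_step.
rewrite sumr_const card_prod card_ord card_bool [(d * 2)%N]mulnC -(mulr_natl (2 * d)%:R^-1) divff//.
by rewrite pnatr_eq0 muln_eq0/= -lt0n.
Qed.

Lemma pr_steps_along k u : pr P (steps_along 0 k u) = ((2 * d)%:R^-1) ^+ k.
Proof.
pose J := [fset j in iota 0 k]%fset.
pose E j := [set w | step S j w = neighbor_step d (u j)].
have -> : steps_along 0 k u = \bigcap_(j in [set` J]) E j.
  apply/seteqP; split => w /= H j.
    by rewrite /= !inE mem_iota add0n => /H; rewrite add0n.
  by move=> jk; rewrite add0n; apply: H; rewrite /= !inE mem_iota.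
rewrite (independent_pr _ _ _ _ _ (srw_indep srw)).
- under eq_bigr do rewrite pr_neighbor_step.
  by rewrite big_const_seq count_predT iter_mulr_1 card_fseq undup_id ?iota_uniq// size_iota.
- by move=> j _; exists [set neighbor_step d (u j)] => //; rewrite setTI.
- by move=> j _; exact: (measurable_step_pred j (fun x => x = _)).
Qed.

(** Form of the Markov property: prescribing the later steps as well lets the
    induction on [t] rest on the product rule for single steps alone, without
    reference to the sigma-algebra of the past. *)
Lemma pr_confined_at_steps M t y k u :
  pr P (confined_at M t y `&` steps_along t k u)
    <= killed_kernel R d M t y * ((2 * d)%:R^-1) ^+ k.
Proof.
elim: t y k u => [|t IH] y k u.
  have [[y0 yB]|ny] := pselect (y = 0 /\ lattice_ball d M y).
    rewrite /= (asboolT yB) y0 eqxx mul1r -(pr_steps_along k u).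
    apply: le_pr; last exact: subIsetr.
      by apply: measurableI; [exact: measurable_confined_at|exact: measurable_steps_along].
    exact: measurable_steps_along.
  have -> : confined_at M 0 y `&` steps_along 0 k u = set0.
    apply/seteqP; split => // w [[Sy SB] _]; apply: ny.
    split; first by rewrite -Sy (srw_start srw).
    by rewrite -Sy; exact: SB.
  rewrite {1}/pr measure0; apply: mulr_ge0; first exact: killed_kernel_ge0.
  by rewrite exprn_ge0// invr_ge0.
have [yB|yB] := pselect (lattice_ball d M y); last first.
  have -> : confined_at M t.+1 y `&` steps_along t.+1 k u = set0.
    apply/seteqP; split => // w [[Sy SB] _]; apply: yB.
    by rewrite -Sy; exact: SB.
  by rewrite {1}/pr measure0 killed_kernel_out// mul0r.
(* Split according to the last step [e] before time [t.+1], and prescribe it. *)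
pose u' e (j : nat) := if j is j'.+1 then u j' else e.
pose F e := confined_at M t (y - neighbor_step d e) `&` steps_along t k.+1 (u' e).
have mF e : measurable (F e).
  by apply: measurableI; [exact: measurable_confined_at|exact: measurable_steps_along].
have mN : measurable (non_neighbor_step t).
  exact: (measurable_step_pred t (fun x => forall e, x <> neighbor_step d e)).
have mU : measurable (\bigcup_(e in [set: 'I_d * bool]) F e).
  by apply: fin_bigcup_measurable.
have mX : measurable (confined_at M t.+1 y `&` steps_along t.+1 k u).
  by apply: measurableI; [exact: measurable_confined_at|exact: measurable_steps_along].
apply: (@le_trans _ _ (pr P (non_neighbor_step t `|` \bigcup_(e in [set: 'I_d * bool]) F e))).
  apply: le_pr => //; first exact: measurableU.
  move=> w [[Sy SB] Sk].
  have [[e Se]|nS] := pselect (exists e, step S t w = neighbor_step d e); last first.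
    by left => e Se; apply: nS; exists e.
  right; exists e => //; split.
    split; first by rewrite -Se -Sy /step subKr.
    by move=> s st; apply: SB; exact: leqW.
  move=> [|j] jk /=; first by rewrite addn0.
  by rewrite addnS -addSn; exact: Sk.
apply: le_trans (pr_setU_le _ _ _ _ _) _ => //.
rewrite pr_non_neighbor_step add0r.
apply: le_trans (pr_cover_finite P _ F _ _ _ _) _ => //.
  by move=> w [e _ Fe]; exists e.
rewrite /= (asboolT yB) mulrAC -mulrA mulr_suml; apply: ler_sum => e _.
by rewrite -exprSr; exact: IH.
Qed.

Lemma pr_confined_at M t y : pr P (confined_at M t y) <= killed_kernel R d M t y.
Proof.
have e0 : 'I_d * bool := (Ordinal d0, true).
have := pr_confined_at_steps M t y 0 (fun=> e0).
rewrite expr0 mulr1; congr (pr P _ <= _).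
by apply/seteqP; split => [w []//|w h]; split.
Qed.

(** The walk visits [y] before it leaves the ball of radius [M]. *)
Definition confined_hit M y : set T := \bigcup_t confined_at M t y.

Lemma pr_confined_hit M y b :
  (forall n, \sum_(t < n) killed_kernel R d M t y <= b) ->
  pr P (confined_hit M y) <= b.
Proof.
move=> Kb; apply: (pr_cover_countable P (fun t => confined_at M t y)) => //.
- by apply: bigcupT_measurable => t; exact: measurable_confined_at.
- by move=> t; exact: measurable_confined_at.
move=> n; apply: le_trans (Kb n); apply: ler_sum => t _; exact: pr_confined_at.
Qed.

Lemma walk_sigma_setI (A B : set T) :
  walk_sigma S A -> walk_sigma S B -> walk_sigma S (A `&` B).
Proof.
exact: (@measurableI _ (g_sigma_algebraType (\bigcup_t rv_sigma (S t)))).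
Qed.

Lemma confined_hit_walk_sigma M y : walk_sigma S (confined_hit M y).
Proof.
pose G := \bigcup_t rv_sigma (S t).
have gen t (Q : lattice d -> Prop) : walk_sigma S [set w | Q (S t w)].
  apply: sub_sigma_algebra; exists t => //.
  by exists [set x | Q x] => //; rewrite setTI.
apply: sigma_algebra_bigcup => t.
have -> : confined_at M t y = [set w | S t w = y] `&`
    \bigcap_(s in [set s | (s <= t)%N]) [set w | lattice_ball d M (S s w)].
  by apply/seteqP; split.
apply: walk_sigma_setI; first exact: (gen t (fun x => x = y)).
apply: (@bigcap_measurableType _ (g_sigma_algebraType G)) => s _; exact: gen.
Qed.

Lemma walk_sigma_setC (A : set T) : walk_sigma S A -> walk_sigma S (~` A).
Proof. exact: (@measurableC _ (g_sigma_algebraType (\bigcup_t rv_sigma (S t)))). Qed.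

End one_walk.

(** * Independent blocks of events *)

Section blocks.
Context {R : realType} {disp : measure_display} {T : measurableType disp}.
Variable P : probability T R.
Variable G : nat -> set T.
Hypothesis mG : forall k, measurable (G k).
Hypothesis indG : forall J : {fset nat},
  pr P (\bigcap_(k in [set` J]) G k) = \prod_(k <- J) pr P (G k).
Variable b : nat -> nat.
Hypothesis b_mono : forall i, (b i <= b i.+1)%N.

(** All events with index in [s] occur. *)
Definition all_of (s : seq nat) : set T := [set w | forall k, k \in s -> G k w].

(** In each of the first [l] blocks of indices [b i <= k < b i.+1] some event
    [G k] does not occur. *)
Definition every_block_fails (l : nat) : set T :=
  [set w | forall i, (i < l)%N ->
    exists k, [/\ (b i <= k)%N, (k < b i.+1)%N & ~ G k w]].

Lemma measurable_all_of s : measurable (all_of s).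
Proof. by apply: (@bigcap_measurableType _ _ G [set k | k \in s]). Qed.

Lemma measurable_every_block_fails l : measurable (every_block_fails l).
Proof.
apply: (@bigcap_measurableType _ _
  (fun i => [set w | exists k, [/\ (b i <= k)%N, (k < b i.+1)%N & ~ G k w]])
  [set i | (i < l)%N]) => i _.
have -> : [set w | exists k, [/\ (b i <= k)%N, (k < b i.+1)%N & ~ G k w]] =
   \bigcup_(k in [set k | (b i <= k)%N /\ (k < b i.+1)%N]) ~` G k.
  by apply/seteqP; split => w [k]; [move=> [? ? ?]; exists k|move=> [? ?] ?; exists k].
by apply: bigcup_measurable => k _; exact: measurableC.
Qed.

Lemma pr_all_of s : uniq s -> pr P (all_of s) = \prod_(k <- s) pr P (G k).
Proof.
move=> us; have -> : all_of s = \bigcap_(k in [set` [fset k in s]%fset]) G k.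
  by apply/seteqP; split => w H k /=; rewrite ?inE => ks; apply: H; rewrite /= ?inE.
rewrite indG; apply: perm_big; apply: uniq_perm => //.
by move=> k; rewrite inE.
Qed.

(** Adding the conjunction over later indices [s] makes the induction on the
    number of blocks go through: the last block is handled by taking a
    complement, which turns it into a part of [s]. *)
Lemma pr_every_block_fails_all_of l s : uniq s ->
  (forall k, k \in s -> (b l <= k)%N) ->
  pr P (every_block_fails l `&` all_of s) =
  (\prod_(i < l) (1 - \prod_(b i <= k < b i.+1) pr P (G k))) *
  \prod_(k <- s) pr P (G k).
Proof.
elim: l s => [|l IH] s us sb.
  rewrite big_ord0 mul1r -pr_all_of//; congr (pr P _).
  by apply/seteqP; split => [w []|w h]//; split.
pose s' := index_iota (b l) (b l.+1) ++ s.
have us' : uniq s'.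
  rewrite cat_uniq us iota_uniq andbT /=; apply/hasPn => k ks /=.
  by rewrite mem_index_iota ltnNge sb// andbF.
have sb1 k : k \in s -> (b l <= k)%N.
  by move=> /sb; exact: leq_trans.
have sb' k : k \in s' -> (b l <= k)%N.
  by rewrite mem_cat mem_index_iota => /orP[/andP[]//|/sb1].
have E1 : every_block_fails l.+1 `&` all_of s =
    (every_block_fails l `&` all_of s) `\` all_of (index_iota (b l) (b l.+1)).
  apply/seteqP; split => w [].
    move=> fw sw; split; first by split => // i il; apply: fw; exact: leqW.
    move=> bw; have [k [k1 k2]] := fw l (leqnn _); apply.
    by apply: bw; rewrite mem_index_iota k1.
  move=> [fw sw] nb; split => // i; rewrite ltnS leq_eqVlt => /orP[/eqP ->|]; last exact: fw.
  apply: contra_notP nb => /forallNP nb k; rewrite mem_index_iota => /andP[k1 k2].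
  by apply: contrapT => nG; apply: (nb k).
have E2 : (every_block_fails l `&` all_of s) `&` all_of (index_iota (b l) (b l.+1))
    = every_block_fails l `&` all_of s'.
  rewrite -setIA; congr (_ `&` _); apply/seteqP; split => w.
    by move=> [h1 h2] k; rewrite mem_cat => /orP[/h2|/h1].
  by move=> h; split => k ks; apply: h; rewrite mem_cat ks ?orbT.
have := pr_split P (every_block_fails l `&` all_of s)
   (all_of (index_iota (b l) (b l.+1))).
rewrite E2 -E1 !IH// big_cat/= => h.
rewrite big_ord_recr/= mulrBr mulr1 mulrBl.
have {}h := h (measurableI _ _ (measurable_every_block_fails l) (measurable_all_of s))
              (measurable_all_of _).
by apply/eqP; rewrite eq_sym subr_eq h mulrA.
Qed.

Lemma pr_every_block_fails l : pr P (every_block_fails l) =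
  \prod_(i < l) (1 - \prod_(b i <= k < b i.+1) pr P (G k)).
Proof.
have := @pr_every_block_fails_all_of l [::] isT.
rewrite big_nil mulr1 => <-//; congr (pr P _).
by apply/seteqP; split => [w h|w []]//; split.
Qed.

Lemma onem_ge_expR (p : R) : 0 <= p <= 1 / 2 -> expR (- (2 * p)) <= 1 - p.
Proof.
move=> /andP[p0 p1]; rewrite expRN -div1r ler_pdivrMr ?expR_gt0//.
have := expR_ge1Dx (2 * p); nra.
Qed.

Lemma prod_ge_expR (p : R) i : 0 <= p <= 1 / 2 ->
  (forall k, (b i <= k < b i.+1)%N -> pr P (~` G k) <= p) ->
  expR (- (2 * p * (b i.+1 - b i)%:R)) <= \prod_(b i <= k < b i.+1) pr P (G k).
Proof.
move=> p01 Gp.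
apply: (@le_trans _ _ (\prod_(b i <= k < b i.+1) expR (- (2 * p)))).
  by rewrite prodr_const_nat -expRM_natl mulrN mulrC.
rewrite big_nat_cond [in leRHS]big_nat_cond; apply: ler_prod => k /andP[kb _].
rewrite expR_ge0/=; apply: le_trans (onem_ge_expR _ p01) _.
have := Gp k kb; rewrite pr_setC//; lra.
Qed.

(** The lengths of the blocks are arbitrary, only their total is used: by
    convexity of the exponential the worst case is that of equal lengths. *)
Lemma pr_every_block_fails_le (p a : R) l : (0 < l)%N -> 0 <= p <= 1 / 2 ->
  (forall k, (b 0 <= k < b l)%N -> pr P (~` G k) <= p) ->
  2 * p * (b l)%:R <= l%:R * a ->
  pr P (every_block_fails l) <= expR (- (l%:R * expR (- a))).
Proof.
move=> l0 p01 Gp pa; rewrite pr_every_block_fails.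
have bm i j : (i <= j)%N -> (b i <= b j)%N.
  exact: (homo_leq leqnn leq_trans b_mono).
pose x (i : nat) : R := 2 * p * (b i.+1 - b i)%:R.
apply: (@le_trans _ _ (\prod_(i < l) expR (- expR (- x i)))).
  apply: ler_prod => i _; apply/andP; split.
    rewrite subr_ge0; apply: Num.Theory.prodr_ile1 => k _.
    by rewrite pr_ge0 pr_le1.
  apply: le_trans (_ : _ <= 1 - expR (- x i)) _.
    rewrite lerD2l lerN2; apply: prod_ge_expR => // k /andP[k1 k2]; apply: Gp.
    rewrite (leq_trans _ k1) ?bm//=; apply: leq_trans k2 _; exact: bm.
  exact: expR_ge1Dx.
rewrite -expR_sum ler_expR sumrN lerN2.
(* Tangent line of [exp (- x)] at [x = a]. *)
have tang i : expR (- a) * (1 + a - x i) <= expR (- x i).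
  have -> : expR (- x i) = expR (- a) * expR (a - x i).
    by rewrite -expRD; congr expR; ring.
  by rewrite ler_wpM2l ?expR_ge0// -addrA expR_ge1Dx.
apply: le_trans (ler_sum _ (fun i _ => tang (nat_of_ord i))).
rewrite -mulr_sumr mulrC ler_wpM2l ?expR_ge0//.
rewrite sumrB sumr_const card_ord -(mulr_natl (1 + a)) mulrDr mulr1.
have -> : \sum_(i < l) x i = 2 * p * (b l - b 0)%:R.
  rewrite -mulr_sumr; congr (_ * _).
  rewrite -natr_sum; congr _%:R.
  by rewrite -(big_mkord predT (fun i => b i.+1 - b i)%N) telescope_sumn.
have : 2 * p * (b l - b 0)%:R <= 2 * p * (b l)%:R.
  rewrite ler_wpM2l ?ler_nat ?leq_subr//; move/andP: p01 => [? ?]; lra.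
move: (l%:R * a) pa => u; lra.
Qed.

End blocks.

(** * Clusters and the volume of balls *)

Section cluster.
Variable d : nat.
Implicit Types (B : set (lattice d)) (s : nat -> nat -> lattice d).

Lemma exit_timeP B (r : nat -> lattice d) t :
  exit_time B r = Some t <-> (~ B (r t) /\ forall u, (u < t)%N -> B (r u)).
Proof.
rewrite /exit_time; case: pselect => [ex|nex]; last first.
  split => // -[nB _]; exfalso; apply: nex; exists t; exact/asboolP.
case: ex_minnP => m /asboolP nBm minm; split.
  move=> [<-]; split => // u um; apply: contrapT => /asboolP/minm.
  by rewrite leqNgt um.
move=> [nBt Bu]; congr Some; apply/eqP; rewrite eqn_leq minm ?andTb; last exact/asboolP.
by rewrite leqNgt; apply/negP => /Bu.
Qed.

Lemma exit_timePN B (r : nat -> lattice d) :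
  exit_time B r = None <-> (forall u, B (r u)).
Proof.
rewrite /exit_time; case: pselect => [ex|nex]; split => //.
  by move=> Br; exfalso; case: ex => t /asboolP; apply.
by move=> _ u; apply: contrapT => nB; apply: nex; exists u; exact/asboolP.
Qed.

Lemma dla_cluster_mono s N N' : (N <= N')%N ->
  dla_cluster s N `<=` dla_cluster s N'.
Proof.
move=> /subnK <-; elim: (_ - _)%N => // k IH x /IH.
by rewrite addSn /=; left.
Qed.

Lemma finite_dla_cluster s N : finite_set (dla_cluster s N).
Proof.
elim: N => [|N IH] /=; first exact: finite_set0.
rewrite finite_setU; split => //; apply: finite_image.
case: (exit_time _ _) => [t|].
  by apply: (sub_finite_set (B := [set t])); [move=> u [->]|exact: finite_set1].
by apply: (sub_finite_set (B := set0)); [move=> u []|exact: finite_set0].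
Qed.

(** A site that joins the cluster between times [N] and [N'] is visited by one of
    the walks in between, which has until then stayed in any set containing the
    final cluster. *)
Lemma settled_site_hit s (B : set (lattice d)) z N N' :
  ~ dla_cluster s N z -> dla_cluster s N' z -> dla_cluster s N' `<=` B ->
  exists k, [/\ (N <= k)%N, (k < N')%N &
    exists t, s k t = z /\ forall u, (u <= t)%N -> B (s k u)].
Proof.
move=> nz; elim: N' => [|N' IH] //= Az AB.
have [z'|z'] := pselect (dla_cluster s N' z).
  have [|k [k1 k2 k3]] := IH z'; first by move=> x Ax; apply: AB; left.
  by exists k; split => //; exact: leqW.
have NN' : (N <= N')%N.
  rewrite leqNgt; apply/negP => N'N; apply: nz.
  exact: (dla_cluster_mono s N'.+1).
case: Az => // -[t /= et zE]; have [nB Bu] := (exit_timeP _ _ _).1 et.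
exists N'; split => //; exists t; split => // u.
rewrite leq_eqVlt => /orP[/eqP ->|/Bu ?]; last by apply: AB; left.
by apply: AB; right; exists t.
Qed.

End cluster.

Section ball_count.
Variables (R : realType) (d : nat).
Notation ball r := (lattice_ball d (r : R)).

(* The cube of side [2n + 1] centred at the origin. *)
Let box (n : nat) (f : {ffun 'I_d -> 'I_(n.*2.+1)}) : lattice d :=
  \row_i ((f i : nat)%:Z - n%:Z).

Let ball_sub_box n : ball n%:R `<=` range (box n).
Proof.
move=> x xn.
have bd i : (absz (x 0%R i) <= n)%N.
  have := sqr_coord_le R d x i; rewrite -sqr_euclid_norm => h.
  have : euclid_norm R x ^+ 2 < n%:R ^+ 2.
    by rewrite ltr_pXn2r ?nnegrE ?euclid_norm_ge0.
  move=> /(le_lt_trans h) {}h.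
  have : (x 0 i) ^+ 2 < n%:Z ^+ 2.
    by rewrite -(ltr_int R) !rmorphXn.
  nia.
exists [ffun i => inord (absz (x 0 i + n%:Z))] => //.
apply/rowP => i; rewrite !mxE ffunE inordK; have := bd i; lia.
Qed.

Lemma finite_ball n : finite_set (ball n%:R).
Proof.
apply: sub_finite_set (@ball_sub_box n) _; apply: finite_image; exact: finite_finset.
Qed.

(** Number of lattice sites in the open ball of radius [n]. *)
Definition ball_volume (n : nat) : nat := #|` fset_set (ball n%:R) |.

Lemma le_ball_volume n m : (n <= m)%N -> (ball_volume n <= ball_volume m)%N.
Proof.
move=> nm; apply: fsubset_leq_card; apply/fsubsetP => x.
rewrite !in_fset_set; [|exact: finite_ball..]; rewrite !inE => h.
by apply: lt_le_trans h _; rewrite ler_nat.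
Qed.

Lemma ball_volume_le n : (ball_volume n <= (n.*2.+1) ^ d)%N.
Proof.
pose J := [fset box n f | f in enum {: {ffun 'I_d -> 'I_(n.*2.+1)}}]%fset.
apply: (@leq_trans #|` J|).
  apply: fsubset_leq_card; apply/fsubsetP => x.
  rewrite in_fset_set ?inE; last exact: finite_ball.
  move=> /ball_sub_box[f _ <-]; apply/imfsetP; exists f => //=.
  by rewrite mem_enum.
apply: leq_trans (leq_imfset_card _ _ _) _.
apply: leq_trans (_ : _ <= size (enum {ffun 'I_d -> 'I_(n.*2.+1)}))%N _.
  by apply: uniq_leq_size => [|f _]; [exact: enum_finmem_uniq|rewrite mem_enum].
by rewrite -cardE card_ffun !card_ord.
Qed.

End ball_count.

Section errors.
Variables (R : realType) (d : nat) (s : nat -> nat -> lattice d) (n : nat).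

Lemma outer_error_lt (h : R) : outer_error R s n < h ->
  dla_cluster s (ball_volume R d n) `<=` lattice_ball d (n%:R + h).
Proof.
rewrite /outer_error ltrBlDl => oh x Ax.
set D := [set r : R | _] in oh.
have D0 : D !=set0.
  have /finite_fsetP[F FE] := finite_dla_cluster d s (ball_volume R d n).
  exists (1 + \sum_(y <- F) euclid_norm R y); split.
    by rewrite addr_ge0// sumr_ge0// => y _; exact: euclid_norm_ge0.
  move=> y; rewrite /ball_cluster FE /= => yF.
  rewrite /lattice_ball/= (big_fsetD1 y)//= addrCA ltrDl ltr_pwDl//.
  by rewrite sumr_ge0// => z _; exact: euclid_norm_ge0.
have [r [r0 Ar] rh] := inf_lt D0 oh.
by apply: lt_trans rh; exact: Ar.
Qed.

Lemma inner_error_lt (h : R) x : h <= n%:R -> inner_error R s n < h ->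
  euclid_norm R x <= n%:R - h -> dla_cluster s (ball_volume R d n) x.
Proof.
rewrite /inner_error ltrBlDr -ltrBlDl => hn ih xh.
set D := [set r : R | _] in ih.
have D0 : D !=set0.
  exists 0; split => // y; rewrite /lattice_ball/= => y0.
  by have := lt_le_trans y0 (euclid_norm_ge0 R d y); rewrite ltxx.
have [r [r0 rA] rh] := sup_gt D0 ih.
by apply: rA; exact: le_lt_trans xh rh.
Qed.

End errors.

(** * Measurability of events defined by the cluster *)

Section cluster_measurability.
Context {disp : measure_display} {T : measurableType disp}.
Variables (d : nat) (S : nat -> nat -> T -> lattice d).
Hypothesis mS : forall N t (Q : lattice d -> Prop), measurable [set w | Q (S N t w)].

Lemma measurable_const_prop (Q : Prop) : measurable [set _ : T | Q].
Proof.
have [q|nq] := pselect Q.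
  by rewrite (_ : [set _ | Q] = setT)//; apply/seteqP; split.
by rewrite (_ : [set _ | Q] = set0)//; apply/seteqP; split.
Qed.

Lemma measurable_exit_time N (B : set (lattice d)) (o : option nat) :
  measurable [set w | exit_time B (fun t => S N t w) = o].
Proof.
case: o => [t|].
  have -> : [set w | exit_time B (fun t => S N t w) = Some t] =
      [set w | ~ B (S N t w)] `&`
      \bigcap_(u in [set u | (u < t)%N]) [set w | B (S N u w)].
    by apply/seteqP; split => w /= /exit_timeP.
  apply: measurableI; first exact: (mS N t (fun x => ~ B x)).
  by apply: bigcap_measurableType => u _; exact: mS.
have -> : [set w | exit_time B (fun t => S N t w) = None] =
    \bigcap_u [set w | B (S N u w)].
  apply/seteqP; split => w /=.
    by move=> /exit_timePN Bw u _; exact: Bw.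
  by move=> Bw; apply/exit_timePN => u; exact: Bw.
by apply: bigcapT_measurable => u; exact: mS.
Qed.

(** The cluster is a finite subset of a countable set, so it takes countably many
    values; any property of it defines an event. *)
Lemma measurable_cluster_pred N (Q : set (lattice d) -> Prop) :
  measurable [set w | Q (dla_cluster (fun N t => S N t w) N)].
Proof.
elim: N Q => [|N IH] Q; first exact: (measurable_const_prop (Q set0)).
have -> : [set w | Q (dla_cluster (fun N t => S N t w) N.+1)] =
  \bigcup_(F : {fset lattice d}) \bigcup_(o : option nat)
   ([set w | dla_cluster (fun N t => S N t w) N = [set` F]] `&`
    ([set w | exit_time [set` F] (fun t => S N t w) = o] `&`
     [set w | Q ([set` F] `|` [set S N t w | t in [set t | o = Some t]])])).
  apply/seteqP; split => [w Qw|w [F _ [x _ [E1 [E2 E3]]]]]; last first.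
    by move: E1 E2 E3 => /= -> ->.
  have /finite_fsetP[F FE] := finite_dla_cluster d (fun N t => S N t w) N.
  exists F => //; exists (exit_time [set` F] (fun t => S N t w)) => //.
  by split => //; split => //; rewrite /= -FE.
apply: countable_bigcupT_measurable => [|F]; first exact: countableP.
apply: countable_bigcupT_measurable => [|o]; first exact: countableP.
apply: measurableI; first exact: (IH (fun A => A = [set` F])).
apply: measurableI; first exact: measurable_exit_time.
case: o => [t|].
  have -> : [set w | Q ([set` F] `|` [set S N u w | u in [set u | Some t = Some u]])] =
     [set w | Q ([set` F] `|` [set S N t w])].
    apply/funext => w /=; congr (Q (_ `|` _)).
    by apply/seteqP; split => x /=; [move=> [u [<-] <-]|move=> ->; exists t].
  exact: (mS N t (fun x => Q ([set` F] `|` [set x]))).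
have -> : [set w | Q ([set` F] `|` [set S N u w | u in [set u | None = Some u]])] =
   [set w | Q [set` F]].
  apply/funext => w /=; congr Q; rewrite -[RHS]setU0; congr (_ `|` _).
  by apply/seteqP; split => x //= [].
exact: (measurable_const_prop (Q [set` F])).
Qed.

End cluster_measurability.

(** * Fluctuations at one scale *)

(** The radius [N], about [exp (2 c H^2) / 2]. *)
Lemma exponential_scale (R : realType) (c : R) (H : nat) : 0 < c -> (0 < H)%N ->
  8 / c <= H%:R ->
  exists N : nat, [/\ (4 * H <= N)%N, c * H%:R ^+ 2 / 2 <= N%:R,
    (N.*2)%:R <= expR (2 * c * H%:R ^+ 2) &
    expR (2 * c * H%:R ^+ 2) / 4 <= N%:R].
Proof.
move=> c0 H0; rewrite ler_pdivrMr// => cH.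
set h : R := H%:R in cH *.
have h1 : 1 <= h by rewrite ler1n.
set X := expR _.
have X1 : 1 + 2 * c * h ^+ 2 <= X by exact: expR_ge1Dx.
have ch : 8 * h <= c * h ^+ 2 by rewrite expr2 mulrA; nra.
pose N := Num.truncn (X / 2).
have /truncn_itv/andP[N1 N2] : 0 <= X / 2 by lra.
rewrite -/N in N1 N2.
rewrite -(natr1 N) in N2.
exists N; split.
- rewrite -(ler_nat R) natrM -/h; lra.
- lra.
- by rewrite -muln2 natrM; lra.
- lra.
Qed.

Section scale.
Variables (R : realType) (d : nat).
Hypothesis d3 : (3 <= d)%N.
Context {disp : measure_display} {T : measurableType disp}.
Variables (P : probability T R) (S : nat -> nat -> T -> lattice d).
Hypothesis walks : independent_walks P S.

Let traj (w : T) : nat -> nat -> lattice d := fun N t => S N t w.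

(* [C] is the constant of the bound on expected numbers of visits. *)
Variable C : R.
Hypothesis C0 : 0 < C.
Hypothesis green : forall (i : 'I_d) (m k n : nat), (0 < m)%N -> (0 < k)%N ->
  \sum_(t < n) killed_kernel R d (m + k)%:R t (m%:Z *: delta_mx 0 i)
    <= C * k.+1%:R * (m%:R^-1) ^+ d.-1.

Variables (H N : nat).
Hypothesis H0 : (0 < H)%N.
Hypothesis HN : (4 * H <= N)%N.

Let c : R := 24 * C * 5 ^+ d.
Hypothesis cN : c * H%:R ^+ 2 / 2 <= N%:R.

(* Shell [i] lies between the radii [radius i] and [radius i.+1]; its test site is
   on the middle sphere, on the first axis. The walks of block [i] are those that
   are added between the clusters of these two radii. *)
Let i0 : 'I_d := Ordinal (leq_trans (isT : (0 < 3)%N) d3).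
Let radius (i : nat) : nat := (N + 2 * H * i)%N.
Let site (i : nat) : lattice d := (radius i + H)%N%:Z *: delta_mx 0 i0.
Let b (i : nat) : nat := ball_volume R d (radius i).
Let L : nat := (N %/ (2 * H))%N.
(* Index of the block of walk [k] (0 if it is in no block). *)
Let block (k : nat) : nat := xget 0%N [set i | (b i <= k < b i.+1)%N].

(* Walk [k] does not visit the test site of its block before leaving the large ball
   of that block. *)
Let miss (k : nat) : set T :=
  ~` confined_hit d (S k) ((radius (block k) + 3 * H)%:R : R) (site (block k)).

Let b_mono i : (b i <= b i.+1)%N.
Proof. by apply: le_ball_volume; rewrite leq_add2l leq_mul2l leqnSn orbT. Qed.

Let blockE i k : (b i <= k < b i.+1)%N -> block k = i.
Proof.
move=> bk; apply: xget_unique => //= j /andP[j1 j2].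
have bm := homo_leq leqnn leq_trans b_mono.
move/andP: bk => [i1 i2].
apply/eqP; rewrite eqn_leq; apply/andP; split; rewrite leqNgt; apply/negP => ij.
  by have := leq_trans i2 (leq_trans (bm _ _ ij) j1); rewrite ltnn.
by have := leq_trans j2 (leq_trans (bm _ _ ij) i1); rewrite ltnn.
Qed.

Let srw k : simple_random_walk P (S k).
Proof. exact: walks.1. Qed.

Let measurable_hit k (M : R) y : measurable (confined_hit d (S k) M y).
Proof.
apply: bigcupT_measurable => t; exact: (measurable_confined_at P).
Qed.

Let measurable_miss k : measurable (miss k).
Proof. exact: measurableC. Qed.

Let pr_miss (J : {fset nat}) :
  pr P (\bigcap_(k in [set` J]) miss k) = \prod_(k <- J) pr P (miss k).
Proof.
apply: (independent_pr _ _ _ _ _ walks.2) => // k _.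
by apply: walk_sigma_setC; exact: confined_hit_walk_sigma.
Qed.

(* Bound on the probability that a walk visits the test site of its block. *)
Let p : R := 3 * C * H%:R * (N%:R^-1) ^+ d.-1.

Let N0 : (0 < N)%N.
Proof. by lia. Qed.

Let pr_hit_le k : pr P (~` miss k) <= p.
Proof.
rewrite setCK; apply: (pr_confined_hit P) => // n.
have -> : (radius (block k) + 3 * H = radius (block k) + H + 2 * H)%N by lia.
have r0 : (0 < radius (block k) + H)%N by lia.
apply: le_trans (green i0 _ (2 * H)%N n r0 _) _; first by lia.
rewrite /p; apply: ler_pM.
- by rewrite mulr_ge0// ltW.
- by rewrite exprn_ge0// invr_ge0.
- rewrite (mulrC 3 C) -mulrA ler_pM2l//.
  by rewrite -natrM ler_nat; lia.
- rewrite lerXn2r ?nnegrE ?invr_ge0// lef_pV2 ?posrE ?ltr0n// ler_nat /radius.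
  by lia.
Qed.

Let Npow : N%:R ^+ d = N%:R * N%:R ^+ d.-1 :> R.
Proof. by rewrite -exprS; case: d d3. Qed.

Let p_le : 0 <= p <= 1 / 2.
Proof.
have NR0 : (0 : R) < N%:R by rewrite ltr0n.
apply/andP; split.
  by rewrite /p !mulr_ge0 ?exprn_ge0 ?invr_ge0// ltW.
have h1 : 1 <= H%:R :> R by rewrite ler1n.
have five : 1 <= 5 ^+ d :> R by rewrite exprn_ege1//; lra.
have Cc : 24 * C <= c by rewrite /c ler_peMr// mulr_ge0// ltW.
apply: (@le_trans _ _ (3 * C * H%:R * N%:R^-1)).
  rewrite /p ler_wpM2l//; first by rewrite !mulr_ge0// ltW.
  case: d d3 => [|[|e]] // _; rewrite /= exprS ler_piMr ?invr_ge0//.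
  by rewrite exprn_ile1 ?invr_ge0// invf_le1// ler1n.
rewrite ler_pdivrMr//.
have C1 := C0; have cN1 := cN.
have : 24 * C * H%:R <= c * H%:R ^+ 2.
  by rewrite ler_pM ?mulr_ge0 ?(ltW C1)// expr2 ler_peMr.
lra.
Qed.

Let L0 : (0 < L)%N.
Proof. by rewrite divn_gt0; lia. Qed.

Let LN : (2 * H * L <= N)%N.
Proof. by rewrite mulnC leq_trunc_div. Qed.

Let NL : (N <= 4 * H * L)%N.
Proof.
have : (N < L.+1 * (2 * H))%N by rewrite ltn_ceil; lia.
by have := L0; nia.
Qed.

Let block_total : 2 * p * (b L)%:R <= L%:R * (c * H%:R ^+ 2).
Proof.
have NR0 : (0 : R) < N%:R by rewrite ltr0n.
have bL : (b L)%:R <= 5 ^+ d * N%:R ^+ d :> R.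
  rewrite -exprMn -natrM -natrX ler_nat.
  apply: leq_trans (ball_volume_le R d _) _.
  by rewrite leq_exp2r ?(leq_trans _ d3)// /radius; lia.
move/andP: p_le => [p0 _].
apply: (@le_trans _ _ (2 * p * (5 ^+ d * N%:R ^+ d))).
  by rewrite ler_wpM2l// mulr_ge0.
have -> : 2 * p * (5 ^+ d * N%:R ^+ d) = c * H%:R * N%:R / 4.
  rewrite Npow /p /c exprVn; field.
  by rewrite expf_neq0 ?gt_eqF.
have : N%:R <= 4 * H%:R * L%:R :> R by rewrite -!natrM ler_nat.
have cH : 0 <= c * H%:R by rewrite /c !mulr_ge0 ?exprn_ge0// ltW.
rewrite expr2 => h.
have : c * H%:R * N%:R <= c * H%:R * (4 * H%:R * L%:R) by rewrite ler_wpM2l.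
lra.
Qed.

(* [A] is an event on which both errors are smaller than [H] at all radii between
   [N] and [2N]. *)
Variable A : set T.
Hypothesis mA : measurable A.
Hypothesis small : forall w n, A w -> (N <= n <= N.*2)%N ->
  outer_error R (traj w) n < H%:R /\ inner_error R (traj w) n < H%:R.

Let small_fails : A `<=` every_block_fails miss b L.
Proof.
move=> w Aw i iL.
have iL2 : (radius i.+1 <= N.*2)%N.
  by have := LN; rewrite /radius; nia.
have rS : radius i.+1 = (radius i + 2 * H)%N by rewrite /radius; lia.
have ri : (N <= radius i)%N by rewrite /radius; lia.
have [] := small w (radius i) Aw; first by lia.
move=> /outer_error_lt out1 _.
have [] := small w (radius i.+1) Aw; first by lia.
move=> /outer_error_lt out2 /inner_error_lt in2.
have normz : euclid_norm R (site i) = (radius i + H)%:R.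
  rewrite /euclid_norm (bigD1 i0)//= big1 => [|j ji].
    by rewrite addr0 !mxE !eqxx mulr1 sqrtr_sqr ger0_norm.
  by rewrite !mxE (negbTE ji) andbF mulr0 expr0n.
have nz : ~ dla_cluster (traj w) (b i) (site i).
  by move=> /out1; rewrite /lattice_ball/= normz natrD ltxx.
have z : dla_cluster (traj w) (b i.+1) (site i).
  apply: in2; first by rewrite ler_nat; lia.
  by rewrite normz rS lerBrDr -natrD ler_nat; lia.
have [|k [k1 k2 [t [tz tB]]]] := settled_site_hit _ _
   (lattice_ball d ((radius i + 3 * H)%:R : R)) _ _ _ nz z.
  move=> x /out2; rewrite rS -natrD.
  by rewrite (_ : (radius i + 2 * H + H = radius i + 3 * H)%N)//; lia.
exists k; split => //; rewrite /miss (blockE i) ?k1//.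
by apply; exists t.
Qed.

Lemma pr_small_errors : pr P A <= expR (- (L%:R * expR (- (c * H%:R ^+ 2)))).
Proof.
apply: (@le_trans _ _ (pr P (every_block_fails miss b L))).
  by apply: le_pr => //; exact: measurable_every_block_fails.
apply: (pr_every_block_fails_le P miss _ _ b _ p) => //.
Qed.

Lemma pr_small_errors_le : expR (2 * c * H%:R ^+ 2) / 4 <= N%:R ->
  pr P A <= expR (- (c * H%:R / 16)).
Proof.
move=> XN; apply: le_trans pr_small_errors _; rewrite ler_expR lerN2.
have h1 : 1 <= H%:R :> R by rewrite ler1n.
have c0 : 0 < c by rewrite /c !mulr_gt0// exprn_gt0//; lra.
set Y := expR (- _).
have Y0 : 0 < Y by exact: expR_gt0.
set X := expR (c * H%:R ^+ 2).
have XY : X * Y = 1 by rewrite -expRD subrr expR0.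
have XX : expR (2 * c * H%:R ^+ 2) = X * X by rewrite -expRD; congr expR; lra.
have X1 : 1 + c * H%:R ^+ 2 <= X by exact: expR_ge1Dx.
have NL' : N%:R <= 4 * H%:R * L%:R :> R by rewrite -!natrM ler_nat.
rewrite XX in XN.
have X0 : 0 < X by exact: expR_gt0.
have h2 : X * X / 16 <= H%:R * L%:R by lra.
have h3 : X * X / 16 * Y <= H%:R * L%:R * Y by rewrite ler_pM2r.
have : X / 16 <= H%:R * L%:R * Y.
  apply: le_trans h3.
  have -> : X * X / 16 * Y = X * (X * Y) / 16 by ring.
  by rewrite XY mulr1.
move=> h4; rewrite -(ler_pM2l (_ : 0 < H%:R)) ?ltr0n//.
rewrite [leRHS]mulrA; apply: le_trans h4.
have -> : H%:R * (c * H%:R / 16) = c * H%:R ^+ 2 / 16 by ring.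
lra.
Qed.

End scale.

Theorem mainTheorem2 (R : realType) (d : nat) (hd : (3 <= d)%N) :
  exists alpha : R, 0 < alpha /\
    forall (disp : measure_display) (T : measurableType disp)
      (P : probability T R) (S : nat -> nat -> T -> lattice d),
      independent_walks P S ->
      P [set w : T | forall m : nat, exists n : nat, (m <= n)%N /\
           (alpha * Num.sqrt (ln (n%:R : R))
              <= outer_error R (fun N t => S N t w) n \/
            alpha * Num.sqrt (ln (n%:R : R))
              <= inner_error R (fun N t => S N t w) n)] = 1%E.
Proof.
have [C [C0 green]] := sum_killed_kernel_le R d hd.
pose c : R := 24 * C * 5 ^+ d.
have c0 : 0 < c by rewrite /c !mulr_gt0// exprn_gt0.
(* With this choice, [alpha * sqrt (log n) <= H] means [n <= exp (2 c H^2)]. *)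
pose alpha : R := Num.sqrt (2 * c)^-1.
have a0 : 0 < alpha by rewrite sqrtr_gt0 invr_gt0 mulr_gt0.
exists alpha; split => // disp T P S walks.
pose large n w := alpha * Num.sqrt (ln (n%:R : R)) <= outer_error R (fun N t => S N t w) n \/
  alpha * Num.sqrt (ln (n%:R : R)) <= inner_error R (fun N t => S N t w) n.
have mlarge n : measurable [set w | large n w].
  pose Q (A : set (lattice d)) :=
    alpha * Num.sqrt (ln (n%:R : R)) <=
      inf [set r : R | 0 <= r /\ A `<=` lattice_ball d r] - n%:R \/
    alpha * Num.sqrt (ln (n%:R : R)) <=
      n%:R - sup [set r : R | 0 <= r /\ lattice_ball d r `<=` A].
  apply: (measurable_cluster_pred _ S _ (ball_volume R d n) Q) => N t B.
  exact: (measurable_walk_pred P _ _ (walks.1 N)).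
pose small m := \bigcap_(n in [set n | (m <= n)%N]) ~` [set w | large n w].
have msmall m : measurable (small m).
  by apply: bigcap_measurableType => n _; exact: measurableC.
have small0 m : pr P (small m) = 0.
  apply/eqP; rewrite eq_le pr_ge0 andbT; apply/ler_addgt0Pr => e e0; rewrite add0r.
  pose H := (m + Num.truncn (8 / c) + Num.truncn (16 / c / e)).+1.
  have trunc (x : R) : 0 <= x -> x < (Num.truncn x).+1%:R by move=> /truncn_itv/andP[].
  have H8 : 8 / c <= H%:R.
    have t0 : 0 <= 8 / c by rewrite divr_ge0// ltW.
    apply: ltW; apply: lt_le_trans (trunc _ t0) _.
    by rewrite ler_nat /H; lia.
  have He : 16 / c / e <= H%:R.
    have t0 : 0 <= 16 / c / e by rewrite !divr_ge0// ltW.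
    apply: ltW; apply: lt_le_trans (trunc _ t0) _.
    by rewrite ler_nat /H; lia.
  have [N [N1 N2 N3 N4]] := exponential_scale R c H c0 isT H8.
  apply: (@le_trans _ _ (expR (- (c * H%:R / 16)))).
    apply: (pr_small_errors_le R d hd P S walks C C0 green H N) => //.
    move=> w n ws /andP[nN n2N].
    have mn : (m <= n)%N by rewrite /H in N1; lia.
    have aH : alpha * Num.sqrt (ln n%:R) <= H%:R.
      have c2 : 0 <= (2 * c)^-1 by rewrite invr_ge0 mulr_ge0// ltW.
      rewrite -sqrtrM//.
      rewrite -[leRHS](ger0_norm (ler0n R H)) -sqrtr_sqr ler_wsqrtr//.
      rewrite mulrC ler_pdivrMr ?mulr_gt0// mulrC.
      rewrite -[leRHS]expRK ler_ln ?posrE ?expR_gt0 ?ltr0n//; last by lia.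
      by apply: le_trans N3; rewrite ler_nat.
    have /not_orP[/negP h1 /negP h2] := ws n mn.
    rewrite -!ltNge in h1 h2.
    by split; [exact: lt_le_trans h1 aH|exact: lt_le_trans h2 aH].
  rewrite expRN -[leRHS]invrK lef_pV2 ?posrE ?expR_gt0 ?invr_gt0//.
  apply: le_trans (expR_ge1Dx _).
  move: He; rewrite ler_pdivrMr// ler_pdivrMr// => He.
  rewrite -div1r ler_pdivrMr//.
  nra.
pose E := [set w : T | forall m : nat, exists n : nat, (m <= n)%N /\ large n w].
change (P E = 1%E).
have mE : measurable E.
  have -> : E = \bigcap_m \bigcup_(n in [set n | (m <= n)%N]) [set w | large n w].
    apply/seteqP; split => w Ew m.
      by move=> _; have [n [mn ln]] := Ew m; exists n.
    by have [n /= mn ln] := Ew m I; exists n.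
  by apply: bigcapT_measurable => m; apply: bigcup_measurable.
have nE : pr P (~` E) = 0.
  apply/eqP; rewrite eq_le pr_ge0 andbT.
  apply: (pr_cover_countable P small) => //; first exact: measurableC.
    move=> w /existsNP[m nm]; exists m => // n mn lw.
    by apply: nm; exists n.
  by move=> n; rewrite big1.
move: nE; rewrite pr_setC// => /eqP; rewrite subr_eq0 => /eqP E1.
by rewrite (prE P)// -E1.
Qed.
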